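(* Let $X$, $E$, $Y$, $d$, $\mathcal{N}$, $\hat{\mathcal{N}}$, $|\cdot|$, $\alpha,\beta$ be as in the context, let $\lambda_n>0$ for $n\in\mathbb{N}=\{0,1,2,\dots\}$, and let $\{\sigma_n\}_{n\in\mathbb{N}}$ be any sequence such that $\sigma_0$ is a minimizer of $$\min\left\{\lambda_0\, d(\hat{\mathcal{N}},\mathcal{N}(\sigma))^{\alpha}+|\sigma|^{\beta}:\ \sigma\in E\right\}$$ and, for every $n\geq 1$, $\sigma_n$ is a minimizer of $$\min\left\{\lambda_n\, d(\hat{\mathcal{N}},\mathcal{N}(\tilde{\sigma}_{n-1}+\sigma))^{\alpha}+|\sigma|^{\beta}:\ \tilde{\sigma}_{n-1}+\sigma\in E\right\},$$ where $\tilde{\sigma}_n=\sum_{j=0}^n\sigma_j$. If $$\limsup_{n} \frac{2^{\beta n}}{\lambda_n}<+\infty,$$ then $$\lim_n d(\hat{\mathcal{N}},\mathcal{N}(\tilde{\sigma}_n))=\inf\{d(\hat{\mathcal{N}},\mathcal{N}(\sigma)):\ \sigma\in E\}.$$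
   Context: $X$ is a real Banach space with norm $\|\cdot\|$; $E$ is a closed nonempty subset of $X$; $Y$ is a metric space with distance $d$; $\mathcal{N}:E\to Y$ is a (possibly nonlinear) map and $\hat{\mathcal{N}}\in Y$, such that the function $E\ni\sigma\mapsto d(\hat{\mathcal{N}},\mathcal{N}(\sigma))$ is continuous with respect to the norm of $X$. There is a function $|\cdot|:X\to[0,+\infty]$ such that: 1) $|0|=0$ and $|-x|=|x|$ for any $x\in X$; 2) $|x+y|\leq|x|+|y|$ for any $x,y\in X$; 3) $\{x\in E:\ |x|<+\infty\}$ is dense in $E$. $\alpha,\beta$ are fixed positive constants, and it is assumed that for $\hat\sigma=0$ and for any $\hat{\sigma}\in E$, and for any $\lambda>0$, the minimization problem $\min\{\lambda\, d(\hat{\mathcal{N}},\mathcal{N}(\hat{\sigma}+\sigma))^{\alpha}+|\sigma|^{\beta}:\ \hat{\sigma}+\sigma\in E\}$ admits a solution (so sequences $\{\sigma_n\}$ as in the claim exist, though they need not be unique). *)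

(* Defs.v *)
From HB Require Import structures.
From mathcomp Require Import all_boot all_order all_algebra.
From mathcomp Require Import all_classical all_reals all_analysis.
Set Implicit Arguments.
Unset Strict Implicit.
Unset Printing Implicit Defensive.
Import Order.TTheory GRing.Theory Num.Theory.
Import numFieldNormedType.Exports.
Local Open Scope classical_set_scope.
Local Open Scope ring_scope.

(* [pn] plays the role of |.| : X -> [0, +oo] (no homogeneity is required). *)
Definition objective (R : realType) (X : completeNormedModType R)
    (Y : metricType R) (N : X -> Y) (Nhat : Y) (pn : X -> \bar R)
    (alpha beta lambda : R) (c s : X) : \bar R :=
  ((lambda * mdist Nhat (N (c + s)) `^ alpha)%:E + pn s `^ beta)%E.

Definition is_minimizer (R : realType) (X : completeNormedModType R)
    (Y : metricType R) (E : set X) (N : X -> Y) (Nhat : Y) (pn : X -> \bar R)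
    (alpha beta lambda : R) (c s : X) : Prop :=
  E (c + s) /\
  forall t : X, E (c + t) ->
    (objective N Nhat pn alpha beta lambda c s
     <= objective N Nhat pn alpha beta lambda c t)%E.

Definition partial_sum (R : realType) (X : completeNormedModType R)
    (sigma : nat -> X) (n : nat) : X :=
  \sum_(0 <= j < n.+1) sigma j.

(* Main.v *)
(* Let e_n be the distance of Nhat to N at the n-th partial sum.  Comparing
   sigma_n with the competitor 0 shows that e_n is nonincreasing.  If e_n stayed
   above some L greater than the infimum, then by density there would be a point
   z of E with |z| finite and d(Nhat, N z) < L, and comparing sigma_n with the
   jump straight to z would give, with a_n = |z - (partial sum up to n)|,
     |sigma_(n+1)|^beta + c 2^(beta n) <= a_n^beta
   for a constant c > 0, whereas a_(n+1) <= a_n + |sigma_(n+1)|.  Hence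
   b_n = a_n / 2^n is nonincreasing with limit b, and |sigma_(n+1)| / 2^n, squeezed
   between 2 b_(n+1) - b_n and b_n, has the same limit; passing to the limit gives
   b^beta + c <= b^beta, a contradiction. *)
Require Import Defs.
From HB Require Import structures.
From mathcomp Require Import all_boot all_order all_algebra.
From mathcomp Require Import all_classical all_reals all_analysis.
From mathcomp Require Import lra.
Set Implicit Arguments.
Unset Strict Implicit.
Unset Printing Implicit Defensive.
Import Order.TTheory GRing.Theory Num.Theory.
Import numFieldNormedType.Exports.
Local Open Scope classical_set_scope.
Local Open Scope ring_scope.

Lemma powR_continuous_pos (R : realType) (r x : R) :
  0 < x -> {for x, continuous (fun a : R => a `^ r)}.
Proof.
move=> x0; apply/differentiable_continuous/derivable1_diffP.
by apply: derivable_powR; rewrite in_itv/= x0.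
Qed.

Lemma near_le_limn_esup_lty (R : realType) (u : nat -> R) :
  (limn_esup (fun n => (u n)%:E) < +oo)%E ->
  exists2 M : R, 0 < M & \forall n \near \oo, u n <= M.
Proof.
move=> /ereal_inf_lt[_ [V Voo <-]] supV.
(* The supremum over the tail set [V] is only known to be below +oo; if it is -oo, any real bound
   serves. *)
have [M supM] : exists M : R, (ereal_sup [set (u n)%:E | n in V] <= M%:E)%E.
  case: (ereal_sup _) supV => [r _|//|_]; first by exists r.
  by exists 0; rewrite leNye.
exists (Num.max M 1); first by rewrite lt_max ltr01 orbT.
apply: filterS Voo => n Vn; rewrite le_max -lee_fin; apply/orP; left.
by apply: le_trans supM; apply: ereal_sup_ubound; exists n.
Qed.

(** The rescaled form of the contradiction: the doubling inequality forces [b] and [t] to share a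
    limit, which a fixed gap [c] between their powers excludes. *)
Lemma powR_gap_doubling (R : realType) (beta c : R) (b t : nat -> R) :
  0 < beta -> 0 < c ->
  (forall n, 0 <= b n) -> (forall n, 0 <= t n) ->
  (forall n, 2 * b n.+1 <= b n + t n) ->
  ~ (forall n, t n `^ beta + c <= b n `^ beta).
Proof.
move=> beta0 c0 b_ge0 t_ge0 btS gap.
have tb n : t n <= b n.
  rewrite leNgt; apply/negP => bt.
  have := gt0_ltr_powR beta0 (b_ge0 n) (t_ge0 n) bt.
  by have := gap n; lra.
have b_decr : nonincreasing_seq b.
  by apply/nonincreasing_seqP => n; have := btS n; have := tb n; lra.
have b_cvg : cvgn b.
  by apply: nonincreasing_is_cvgn => //; exists 0 => _ [n _ <-].
set l := limn b in b_cvg.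
(* The gap gives c <= b_n^beta, hence b_n >= c^(1/beta) for all n. Positivity of the limit lets the
   power be treated as continuous there. *)
have l_gt0 : 0 < l.
  apply: (@lt_le_trans _ _ (c `^ beta^-1)); first exact: powR_gt0.
  apply: limr_ge => //; apply: nearW => n.
  rewrite -[leRHS](@powRr1 _ (b n)) // -(@mulfV _ beta) ?gt_eqF// powRrM.
  apply: ge0_ler_powR; rewrite ?nnegrE ?invr_ge0 ?powR_ge0 ?(ltW c0) ?(ltW beta0)//.
  by have := gap n; have := powR_ge0 (t n) beta; lra.
have t_cvg : t @ \oo --> l.
  apply: (@squeeze_cvgr _ _ _ _ (fun n => 2 * b n.+1 - b n) b) => //.
    by apply: nearW => n; rewrite tb andbT; have := btS n; lra.
  suff : 2 * b n.+1 - b n @[n --> \oo] --> 2 * l - l.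
    by rewrite mulr_natl mulr2n addrK.
  by apply: cvgB => //; apply: cvgMr; rewrite cvg_shiftS.
have pow_cvg u : u @ \oo --> l -> (u n `^ beta) @[n --> \oo] --> l `^ beta.
  by move=> ul; exact: continuous_cvg (powR_continuous_pos l_gt0) ul.
suff : l `^ beta + c <= l `^ beta by lra.
apply: (ler_cvg_to (cvgD (pow_cvg _ t_cvg) (cvg_cst c)) (pow_cvg _ b_cvg)).
exact: nearW.
Qed.

(** Dividing [a] and [s] by 2^n turns the growing gap into a constant one; shifting indices by [n0]
    makes it hold from the start. *)
Lemma powR_gap_exp (R : realType) (beta c : R) (a s : nat -> R) (n0 : nat) :
  0 < beta -> 0 < c ->
  (forall n, 0 <= a n) -> (forall n, 0 <= s n) ->
  (forall n, a n.+1 <= a n + s n) ->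
  ~ (forall n, (n0 <= n)%N ->
       s n `^ beta + c * 2 `^ (beta * n%:R) <= a n `^ beta).
Proof.
move=> beta0 c0 a_ge0 s_ge0 aS gap.
pose w n : R := 2 `^ (- (n + n0)%:R).
have w_gt0 n : 0 < w n by exact: powR_gt0.
have wS n : 2 * w n.+1 = w n.
  rewrite /w -[X in X * _](@powRr1 _ 2)// -powRD ?implybT ?pnatr_eq0//.
    by congr (_ `^ _); rewrite addSn -natr1; lra.
  by apply/implyP.
apply: (@powR_gap_doubling _ beta c (fun n => a (n + n0)%N * w n)
  (fun n => s (n + n0)%N * w n)) => // n.
- by rewrite mulr_ge0// ltW.
- by rewrite mulr_ge0// ltW.
- rewrite mulrCA wS -mulrDl; apply: ler_wpM2r; [exact: ltW|exact: aS].
rewrite !powRM ?(ltW (w_gt0 n))//.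
(* The weight raised to [beta] cancels the exponential factor exactly, leaving the constant [c]. *)
have wbeta : 2 `^ (beta * (n + n0)%:R) * w n `^ beta = 1.
  by rewrite /w -powRrM mulNr mulrC [_ * beta]mulrC powRN mulVf.
have := gap (n + n0)%N (leq_addl _ _).
move=> /(ler_wpM2r (powR_ge0 (w n) beta)).
by rewrite mulrDl -mulrA wbeta mulr1.
Qed.

(** A competitor of finite size has finite objective, while an infinite [pn s] would make that of
    [s] infinite because [beta] is nonzero. The comparison thus descends to real numbers. *)
Lemma minimizer_fin (R : realType) (X : completeNormedModType R)
    (Y : metricType R) (E : set X) (N : X -> Y) (Nhat : Y) (pn : X -> \bar R)
    (alpha beta lambda : R) (c s t : X) (x : R) :
  0 < beta -> (forall x, (0 <= pn x)%E) ->
  is_minimizer E N Nhat pn alpha beta lambda c s ->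
  E (c + t) -> pn t = x%:E ->
  exists y, [/\ 0 <= y, pn s = y%:E &
    lambda * mdist Nhat (N (c + s)) `^ alpha + y `^ beta <=
    lambda * mdist Nhat (N (c + t)) `^ alpha + x `^ beta].
Proof.
move=> beta0 pn_ge0 [_ min_s] Ect ptx.
have := min_s t Ect; rewrite /objective ptx poweR_EFin -EFinD.
have := pn_ge0 s.
case: (pn s) => [y||//]; last by rewrite poweRyr ?gt_eqF.
rewrite lee_fin poweR_EFin -EFinD lee_fin => y0 le_st.
by exists y.
Qed.

(** Some point of [E] has distance below [L]; by continuity within [E] so do all nearby points of
    [E], and density picks one where [pn] is finite. *)
Lemma dense_finite_lt (R : realType) (X : completeNormedModType R)
    (Y : metricType R) (E : set X) (N : X -> Y) (Nhat : Y)
    (pn : X -> \bar R) (L : R) :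
  E !=set0 ->
  {within E, continuous (fun s : X => mdist Nhat (N s))} ->
  E `<=` closure [set x : X | E x /\ (pn x < +oo)%E] ->
  inf [set mdist Nhat (N s) | s in E] < L ->
  exists z, [/\ E z, (pn z < +oo)%E & mdist Nhat (N z) < L].
Proof.
move=> [x0 Ex0] /subspace_continuousP cont dense.
move=> /inf_lt[|_ [x Ex <-] xL]; first by exists (mdist Nhat (N x0)), x0.
have /dense/(_ _ (cont x Ex _ (lt_nbhsl xL))) := Ex.
by case=> z [[Ez zfin]] /(_ Ez) zL; exists z; split.
Qed.

Theorem theorem2p1 (R : realType) (X : completeNormedModType R)
    (Y : metricType R) (E : set X) (N : X -> Y) (Nhat : Y)
    (pn : X -> \bar R) (alpha beta : R) (lambda : nat -> R)
    (sigma : nat -> X)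
    (E_closed : closed E)
    (E_nonempty : E !=set0)
    (dN_cont : {within E, continuous (fun s : X => mdist Nhat (N s))})
    (pn_ge0 : forall x : X, (0 <= pn x)%E)
    (pn0 : pn 0 = 0%E)
    (pnN : forall x : X, pn (- x) = pn x)
    (pnD : forall x y : X, (pn (x + y)%R <= pn x + pn y)%E)
    (pn_dense : E `<=` closure [set x : X | E x /\ (pn x < +oo)%E])
    (alpha_gt0 : 0 < alpha)
    (beta_gt0 : 0 < beta)
    (min_exists : forall (c : X) (l : R), c = 0 \/ E c -> 0 < l ->
       exists s : X, is_minimizer E N Nhat pn alpha beta l c s)
    (lambda_gt0 : forall n : nat, 0 < lambda n)
    (sigma0_min : is_minimizer E N Nhat pn alpha beta (lambda 0%N) 0 (sigma 0%N))
    (sigmaS_min : forall n : nat,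
       is_minimizer E N Nhat pn alpha beta (lambda n.+1)
         (partial_sum sigma n) (sigma n.+1))
    (lambda_limsup :
       (limn_esup (fun n : nat => (2 `^ (beta * n%:R) / lambda n)%:E) < +oo)%E) :
  (fun n : nat => mdist Nhat (N (partial_sum sigma n))) @ \oo -->
    inf [set mdist Nhat (N s) | s in E].
Proof.
set S := partial_sum sigma; set e := fun n : nat => mdist Nhat (N (S n)).
have SS n : S n.+1 = S n + sigma n.+1 by rewrite /S /partial_sum big_nat_recr.
have S0 : S 0%N = sigma 0%N by rewrite /S /partial_sum big_nat1.
have ES n : E (S n).
  case: n => [|n]; last by rewrite SS; case: (sigmaS_min n).
  by rewrite S0 -[sigma _]add0r; case: sigma0_min.
have pow_le (x y : R) : 0 <= x -> 0 <= y -> x `^ alpha <= y `^ alpha -> x <= y.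
  move=> x0 y0; apply: contraTT; rewrite -!ltNge.
  exact: gt0_ltr_powR.
have eS n : e n.+1 <= e n.
  have := minimizer_fin beta_gt0 pn_ge0 (sigmaS_min n) (t := 0) (x := 0).
  rewrite addr0 -SS => /(_ (ES n) pn0)[y [y0 _]].
  rewrite (@powR0 _ beta) ?gt_eqF// addr0 => le_e.
  apply: pow_le; rewrite ?mdist_ge0//.
  rewrite -(ler_pM2l (lambda_gt0 n.+1)); apply: le_trans le_e.
  by rewrite lerDl powR_ge0.
have e_decr : nonincreasing_seq e by exact/nonincreasing_seqP.
have inf_e n : inf [set mdist Nhat (N s) | s in E] <= e n.
  by apply: ge_inf; [exists 0 => _ [s _ <-]; exact: mdist_ge0|exists (S n)].
(* Since [e] is nonincreasing and bounded below by the infimum, a single index below each larger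
   level gives convergence. *)
suff e_lt L : inf [set mdist Nhat (N s) | s in E] < L -> exists n, e n < L.
  apply/cvgrPdist_lt => eps eps0.
  have [|n en] := e_lt (inf [set mdist Nhat (N s) | s in E] + eps).
    by rewrite ltrDl.
  exists n => // m /= nm; rewrite distrC ger0_norm ?subr_ge0//.
  by rewrite ltrBlDl; exact: le_lt_trans (e_decr _ _ nm) en.
move=> infL; apply: contrapT => /forallNP e_ge.
have {}e_ge n : L <= e n by rewrite leNgt; exact/negP.
have [z [Ez z_fin zL]] := dense_finite_lt E_nonempty dN_cont pn_dense infL.
(* Per unit of [lambda], a jump to [z] lowers the data term by at least [delta] as long as [e] stays
   above [L]. *)
set delta := L `^ alpha - mdist Nhat (N z) `^ alpha.
have L_ge0 : 0 <= L by apply: le_trans (ltW zL); exact: mdist_ge0.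
have delta_gt0 : 0 < delta.
  by rewrite subr_gt0; apply: gt0_ltr_powR; rewrite ?nnegrE ?mdist_ge0.
have [pz pzE] : exists pz, pn z = pz%:E.
  by move: z_fin (pn_ge0 z); case: (pn z) => // r _ _; exists r.
(* The competitor here is [z], since 0 need not lie in [E]; for later increments the competitor 0 is
   admissible. *)
have sigma0_fin : (pn (sigma 0%N) < +oo)%E.
  have := minimizer_fin beta_gt0 pn_ge0 sigma0_min (t := z).
  by rewrite add0r => /(_ _ Ez pzE)[y [_ -> _]]; rewrite ltry.
have a_fin n : exists a, 0 <= a /\ pn (z - S n) = a%:E.
  have : (pn (z - S n)%R < +oo)%E.
    elim: n => [|n IHn].
      rewrite S0; apply: le_lt_trans (pnD _ _) _.
      by rewrite pnN pzE lte_add_pinfty ?ltry.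
    have := minimizer_fin beta_gt0 pn_ge0 (sigmaS_min n) (t := 0) (x := 0).
    rewrite addr0 => /(_ (ES n) pn0)[y [_ yE _]].
    rewrite SS opprD addrA; apply: le_lt_trans (pnD _ _) _.
    by rewrite pnN yE lte_add_pinfty ?ltry.
  have := pn_ge0 (z - S n).
  case: (pn _) => [r|//|//]; rewrite lee_fin => r0 _.
  by exists r.
have [a /all_and2[a_ge0 aE]] := choice a_fin.
have step n : exists s, [/\ 0 <= s, pn (sigma n.+1) = s%:E &
    s `^ beta + lambda n.+1 * delta <= a n `^ beta].
  have := minimizer_fin beta_gt0 pn_ge0 (sigmaS_min n) (t := z - S n).
  rewrite addrC subrK => /(_ _ Ez (aE n))[s [s0 sE le_s]].
  exists s; split => //.
  have : lambda n.+1 * L `^ alpha <= lambda n.+1 * e n.+1 `^ alpha.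
    by rewrite ler_pM2l//; apply: ge0_ler_powR; rewrite ?nnegrE ?mdist_ge0 ?(ltW alpha_gt0).
  by move: le_s; rewrite -SS /delta /e mulrBr; lra.
have [s /all_and3[s_ge0 sE gap]] := choice step.
have aS n : a n.+1 <= a n + s n.
  rewrite -lee_fin EFinD -!aE -sE SS opprD addrA -(pnN (sigma n.+1)).
  exact: pnD.
have [M M0 [n0 _ lambdaM]] := near_le_limn_esup_lty lambda_limsup.
(* For n >= n0 the bound [M] gives lambda_(n+1) >= 2^(beta (n+1)) / M >= 2^(beta n) / M, whence the
   constant [delta / M]; the index shift only helps. *)
apply: (@powR_gap_exp _ beta (delta / M) a s n0) => // [|n n0n].
  exact: divr_gt0.
apply: le_trans (gap n); rewrite lerD2l -mulrA mulrC ler_pM2r//.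
rewrite ler_pdivrMl//.
have := lambdaM n.+1 (leqW n0n); rewrite /= ler_pdivrMr//.
apply: le_trans; apply: ler_powR; first by rewrite ler1n.
by rewrite ler_pM2l// ler_nat.
Qed.
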